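(* The following inequalities are valid: $$(1-x)e^{x}\le\frac{\sinh x}{x}\quad\text{for all real } x>0,$$ $$(1+x)e^{-x}\le\frac{\sinh x}{x}\quad\text{for all real } x<0.$$ *)

(* Defs.v *)
From Stdlib Require Export Reals.

(* Main.v *)
(* Multiplying by [2 x exp (-x)] turns the first inequality into
   [exp (-2x) <= 1 - 2x + 2x^2].  It follows from the Taylor bound
   [exp y >= 1 + y + y^2/2] at [y = 2x] and
   [(1 + y + y^2/2) (1 - y + y^2/2) = 1 + y^4/4 >= 1].  The second inequality
   is the first one at [-x], since [sinh x / x] is even. *)
Require Import Defs.
From Stdlib Require Import Reals.
From Stdlib Require Import Lra Psatz.
Open Scope R_scope.

(** For [0 <= y] every term of the exponential series is nonnegative, so the partial sum [E1 y 2]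
    (degrees 0 to 2) is at most the limit. *)
Lemma exp_ge_quadratic (y : R) : 0 <= y -> 1 + y + y ^ 2 / 2 <= exp y.
Proof.
  intros Hy.
  assert (H : E1 y 2 <= exp y).
  { apply sum_incr; [exact (E1_cvg y) |].
    intros n.
    apply Rmult_le_pos.
    - left; apply Rinv_0_lt_compat, INR_fact_lt_0.
    - apply pow_le, Hy. }
  unfold E1 in H; simpl in H.
  lra.
Qed.

Lemma exp_opp_le_quadratic (y : R) : 0 <= y -> exp (- y) <= 1 - y + y ^ 2 / 2.
Proof.
  intros Hy.
  pose proof (exp_ge_quadratic y Hy) as H.
  rewrite exp_Ropp.
  apply Rmult_le_reg_l with (exp y); [apply exp_pos |].
  rewrite Rinv_r by (pose proof (exp_pos y); lra).
  apply Rle_trans with ((1 + y + y ^ 2 / 2) * (1 - y + y ^ 2 / 2)).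
  - nra.
  (* The common factor is nonnegative: it equals [((1 - y) ^ 2 + 1) / 2]. *)
  - apply Rmult_le_compat_r; [nra | exact H].
Qed.

Lemma sinh_div_ge_pos (x : R) : 0 < x -> (1 - x) * exp x <= sinh x / x.
Proof.
  intros Hx.
  assert (H : exp (- (2 * x)) <= 1 - 2 * x + (2 * x) ^ 2 / 2)
    by (apply exp_opp_le_quadratic; lra).
  assert (E : exp (- x) = exp x * exp (- (2 * x)))
    by (rewrite <- exp_plus; f_equal; ring).
  apply Rmult_le_reg_r with x; [exact Hx |].
  unfold sinh.
  replace ((exp x - exp (- x)) / 2 / x * x) with ((exp x - exp (- x)) / 2)
    by (field; lra).
  rewrite E.
  pose proof (exp_pos x).
  (* The goal is now [H] multiplied by the positive factor [exp x / 2] and rearranged. *)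
  nra.
Qed.

Lemma sinh_div_even (x : R) : x <> 0 -> sinh (- x) / - x = sinh x / x.
Proof.
  intros Hx.
  unfold sinh.
  rewrite Ropp_involutive.
  field.
  exact Hx.
Qed.

Theorem corollary1 :
  (forall x : R, 0 < x -> (1 - x) * exp x <= sinh x / x) /\
  (forall x : R, x < 0 -> (1 + x) * exp (- x) <= sinh x / x).
Proof.
  split; [exact sinh_div_ge_pos |].
  intros x Hx.
  rewrite <- sinh_div_even by lra.
  replace (1 + x) with (1 - - x) by ring.
  apply sinh_div_ge_pos.
  lra.
Qed.
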